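(* Let $\mathbf{x}=(x_1,\dots,x_{n+1})$ be a melody whose slope is defined, i.e. with $n\sum_{i=1}^n x_i^2-\left(\sum_{i=1}^n x_i\right)^2\neq 0$, and let $t\in\mathbb{Z}$. Then $s(M(\mathbf{x}+t))=s(M(\mathbf{x}))$.
   Context: A melody is a finite sequence of integers. For a melody $\mathbf{x}=(x_1,\dots,x_{n+1})$, its M-graph $M(\mathbf{x})$ consists of the points $p_i=(x_i,x_{i+1})\in\mathbb{R}^2$, $1\leq i\leq n$ (listed with multiplicity). The slope $s(P)$ of a finite list of points $P=((x_1,y_1),\dots,(x_N,y_N))$ in $\mathbb{R}^2$ is the slope of the least squares regression line, i.e. $s(P)=\dfrac{N\sum_{i=1}^N x_iy_i-\sum_{i=1}^N x_i\sum_{i=1}^N y_i}{N\sum_{i=1}^N x_i^2-\left(\sum_{i=1}^N x_i\right)^2}$, defined when the denominator is nonzero. For $t\in\mathbb{Z}$, the transposition of $\mathbf{x}$ by $t$ is $\mathbf{x}+t=(x_1+t,\dots,x_{n+1}+t)$. *)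

(* Defs.v *)
From mathcomp Require Import all_boot all_order all_algebra.
From mathcomp Require Import reals.

Set Implicit Arguments.
Unset Strict Implicit.
Unset Printing Implicit Defensive.

Import Order.TTheory GRing.Theory Num.Theory.
Local Open Scope ring_scope.

(* A melody (x_1, ..., x_{n+1}) is a term of type n.+1.-tuple int; indices
   start at 0, so x_i is x`_(i - 1).*)

Definition mgraph (R : realType) (n : nat) (x : n.+1.-tuple int) :
    n.-tuple (R * R) :=
  [tuple ((x`_i)%:~R, (x`_i.+1)%:~R) | i < n].

Definition slope_num (R : realType) (P : seq (R * R)) : R :=
  (size P)%:R * (\sum_(p <- P) p.1 * p.2)
    - (\sum_(p <- P) p.1) * (\sum_(p <- P) p.2).

Definition slope_den (R : realType) (P : seq (R * R)) : R :=
  (size P)%:R * (\sum_(p <- P) p.1 ^+ 2) - (\sum_(p <- P) p.1) ^+ 2.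

(* None encodes an undefined slope: an equation between slopes whose one side
   is defined also asserts that the other is. *)
Definition slope (R : realType) (P : seq (R * R)) : option R :=
  if slope_den P != 0 then Some (slope_num P / slope_den P) else None.

Definition transposition (m : nat) (x : m.-tuple int) (t : int) :
    m.-tuple int :=
  [tuple of [seq a + t | a <- x]].

(* Main.v *)
(* Transposing a melody by t translates its M-graph by (t, t), and the numerator
   and the denominator of the least squares slope are both translation invariant. *)
Require Import Defs.
From mathcomp Require Import all_boot all_order all_algebra.
From mathcomp Require Import reals.
From mathcomp Require Import ring.
Import Order.TTheory GRing.Theory Num.Theory.
Local Open Scope ring_scope.

(** For N points, [slope_num] and [slope_den] are N^2 times the covariance of the two coordinates
    and the variance of the first one. Neither changes when constants are added to the coordinates,
    so by [slope_translate] the slopes are defined together and equal; [mgraph_transposition]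
    supplies the case of the shift (t, t). *)

Lemma big_addr_const (R : pzRingType) (I : Type) (s : seq I) (F : I -> R) (c : R) :
  \sum_(i <- s) (F i + c) = \sum_(i <- s) F i + (size s)%:R * c.
Proof.
by rewrite big_split /= big_const_seq count_predT iter_addr_0 mulr_natl.
Qed.

Lemma slope_num_translate (R : realType) (P : seq (R * R)) (c d : R) :
  slope_num [seq (p.1 + c, p.2 + d) | p <- P] = slope_num P.
Proof.
(* Multiplied by N, the three extra terms are exactly those that appear when (Sx + N c) (Sy + N d)
   is expanded, with Sx and Sy the coordinate sums; hence they cancel in [slope_num]. *)
have sum_xy : \sum_(p <- P) (p.1 + c) * (p.2 + d) =
    \sum_(p <- P) p.1 * p.2 + (\sum_(p <- P) p.1) * d
      + c * (\sum_(p <- P) p.2) + (size P)%:R * (c * d).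
  rewrite mulr_suml mulr_sumr -!big_split -big_addr_const /=.
  by apply: eq_bigr => p _; rewrite mulrDl !mulrDr !addrA.
rewrite /slope_num size_map !big_map /= sum_xy !big_addr_const.
ring.
Qed.

Lemma slope_den_translate (R : realType) (P : seq (R * R)) (c d : R) :
  slope_den [seq (p.1 + c, p.2 + d) | p <- P] = slope_den P.
Proof.
have sum_xx : \sum_(p <- P) (p.1 + c) ^+ 2 =
    \sum_(p <- P) p.1 ^+ 2 + (\sum_(p <- P) p.1) * (c *+ 2)
      + (size P)%:R * c ^+ 2.
  rewrite mulr_suml -big_split -big_addr_const /=.
  by apply: eq_bigr => p _; rewrite sqrrD mulrnAr.
rewrite /slope_den size_map !big_map /= sum_xx big_addr_const.
ring.
Qed.

Lemma slope_translate (R : realType) (P : seq (R * R)) (c d : R) :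
  slope [seq (p.1 + c, p.2 + d) | p <- P] = slope P.
Proof. by rewrite /slope slope_den_translate slope_num_translate. Qed.

Lemma mgraph_transposition (R : realType) (n : nat) (x : n.+1.-tuple int)
    (t : int) :
  mgraph R (transposition x t) =
    [seq (p.1 + t%:~R, p.2 + t%:~R) | p <- mgraph R x] :> seq (R * R).
Proof.
rewrite /= -map_comp; apply: eq_map => i /=.
(* Since i < n, both i and i + 1 index actual notes; beyond the end, the default 0 would not be
   shifted by t. *)
by rewrite !(nth_map 0) ?size_tuple ?ltnS ?(ltnW (ltn_ord i)) // !intrD.
Qed.

Theorem proposition1p2 (R : realType) (n : nat) (x : n.+1.-tuple int) (t : int)
    (hx : n%:Z * (\sum_(i < n) x`_i ^+ 2) - (\sum_(i < n) x`_i) ^+ 2 <> 0) :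
  slope (mgraph R (transposition x t)) = slope (mgraph R x).
Proof. by rewrite mgraph_transposition slope_translate. Qed.
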